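(* Let $D$ be a digraph with $n$ vertices and let $t=maxDiCut(D)$. Then $\tfrac{1}{2}nt\le val(D)\le (n-1)t$, where $val(D)$ denotes the maximum value of an arrangement of $D$.
   Context: Digraphs are simple (no loops or parallel edges; opposite edges allowed). An arrangement of an $n$-vertex digraph $D$ is a bijection $\pi:V(D)\to\{1,\dots,n\}$; for an edge $e=(u,v)$, $val_\pi(e)=\max\{0,\pi(v)-\pi(u)\}$, and $val_D(\pi)=\sum_{e\in E(D)}val_\pi(e)$. For a partition $\{X,Y\}$ of $V(D)$, $E(X,Y)$ is the set of edges with tail in $X$ and head in $Y$; $maxDiCut(D)$ is the maximum of $|E(X,Y)|$ over all such partitions. *)

(* Defs.v *)
From HB Require Import structures.
From mathcomp Require Import all_boot all_order all_algebra.

Set Implicit Arguments.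
Unset Strict Implicit.
Unset Printing Implicit Defensive.

Record digraph := Digraph {
  vertex :> finType;
  edge : rel vertex;
  edge_irreflexive : irreflexive edge
}.

(* E(X, Y), an edge being the ordered pair (tail, head) *)
Definition edges_between (D : digraph) (X Y : {set D}) : {set D * D} :=
  [set e : D * D | [&& edge e.1 e.2, e.1 \in X & e.2 \in Y]].

Definition edges (D : digraph) : {set D * D} :=
  [set e : D * D | edge e.1 e.2].

(* X ranges over all sets, so a part of the partition may be empty. Such a
   partition has no edge from X to Y, hence does not affect the maximum. *)
Definition maxDiCut (D : digraph) : nat :=
  \max_(X : {set D}) #|edges_between X (~: X)|.

(* Positions 1, ..., n are encoded as the ordinals 0, ..., n - 1; see [pos]. *)
Definition arrangement (D : digraph) (pi : {ffun D -> 'I_#|D|}) : bool :=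
  injectiveb pi && [forall k, exists v, pi v == k].

Definition pos (D : digraph) (pi : {ffun D -> 'I_#|D|}) (v : D) : nat :=
  (pi v).+1.

(* Subtraction is truncated on nat, so this is max {0, pi(v) - pi(u)}. *)
Definition edge_val (D : digraph) (pi : {ffun D -> 'I_#|D|}) (e : D * D) : nat :=
  pos pi e.2 - pos pi e.1.

Definition arrangement_val (D : digraph) (pi : {ffun D -> 'I_#|D|}) : nat :=
  \sum_(e in edges D) edge_val pi e.

Definition max_val (D : digraph) : nat :=
  \max_(pi : {ffun D -> 'I_#|D|} | arrangement pi) arrangement_val pi.

(* Main.v *)
Require Import Defs.
From mathcomp Require Import all_boot all_order all_algebra.
From mathcomp Require Import zify lra.

Import Order.TTheory GRing.Theory Num.Theory.
Local Open Scope ring_scope.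

(** Upper bound: a forward edge [(u, v)] contributes [pi v - pi u] by crossing that
    many of the [n - 1] cuts between consecutive positions, and no cut is crossed
    by more than [t] edges.  Lower bound: for a maximum dicut [(X, ~: X)], list
    [X] in any order and then [~: X] in any order; reversing both blocks sends
    positions [i] to [|X| - 1 - i] on [X] and [j] to [n + |X| - 1 - j] on [~: X],
    so the values of a cut edge under the two arrangements sum to [n]. *)

(** Counts the cuts [k] that separate position [a] from a later position [b]; for [b <= a] both
    sides vanish. *)
Lemma subn_sum_nat (m a b : nat) : (b <= m)%N ->
  (b - a = \sum_(k < m) (a <= k < b))%N.
Proof.
elim: m b => [|m IH] b hb; first by rewrite big_ord0; lia.
(* The new term [k = m] can be nonzero only if [b = m.+1]; the remaining sum is then the one for
   [b = m]. *)
rewrite big_ord_recr /=; have [->|hb'] := eqVneq b m.+1.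
  under eq_bigr => k _.
    have -> : (a <= k < m.+1)%N = (a <= k < m)%N by have := ltn_ord k; lia.
    over.
  by rewrite -IH //; lia.
by rewrite -IH; lia.
Qed.

Lemma card_edges_between (D : digraph) (X Y : {set D}) :
  (#|edges_between X Y| =
     \sum_(e in edges D) ((e.1 \in X) && (e.2 \in Y)))%N.
Proof.
rewrite -sum1_card big_mkcond [RHS]big_mkcond /=; apply: eq_bigr => e _.
by rewrite !inE; case: edge => //=; case: (_ && _).
Qed.

Lemma leq_maxDiCut (D : digraph) (X : {set D}) :
  (#|edges_between X (~: X)| <= maxDiCut D)%N.
Proof.
exact: (leq_bigmax (F := fun X : {set D} => #|edges_between X (~: X)|)).
Qed.

Lemma arrangement_val_le (D : digraph) (pi : {ffun D -> 'I_#|D|}) :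
  (arrangement_val pi <= #|D|.-1 * maxDiCut D)%N.
Proof.
rewrite /arrangement_val.
have -> : (\sum_(e in edges D) edge_val pi e = \sum_(k < #|D|.-1)
    #|edges_between [set v | pi v <= k] (~: [set v | pi v <= k])|)%N.
  under [RHS]eq_bigr do rewrite card_edges_between.
  rewrite exchange_big /=; apply: eq_bigr => e _.
  rewrite /edge_val /pos subSS (@subn_sum_nat #|D|.-1); last first.
    by have := ltn_ord (pi e.2); lia.
  by apply: eq_bigr => k _; rewrite !inE -ltnNge.
apply: (@leq_trans (\sum_(k < #|D|.-1) maxDiCut D)%N).
  by apply: leq_sum => k _; apply: leq_maxDiCut.
by rewrite sum_nat_const card_ord.
Qed.

(** Lets an arrangement be given as a list of the vertices; surjectivity follows from injectivity by
    counting. *)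
Lemma arrangement_of_seq (D : digraph) (s : seq D) : perm_eq s (enum D) ->
  exists2 pi : {ffun D -> 'I_#|D|}, arrangement pi &
    forall v, pi v = index v s :> nat.
Proof.
move=> ps; have size_s : size s = #|D| by rewrite (perm_size ps) cardE.
have mem_s v : v \in s by rewrite (perm_mem ps) mem_enum.
have lt_index v : (index v s < #|D|)%N by rewrite -size_s index_mem.
exists [ffun v => Ordinal (lt_index v)] => [|v]; last by rewrite ffunE.
have inj_pi : injective [ffun v => Ordinal (lt_index v)].
  move=> u v; rewrite !ffunE => /(congr1 val) /= eq_uv.
  by rewrite -(nth_index u (mem_s u)) eq_uv nth_index.
apply/andP; split; first exact/injectiveP.
apply/forallP => k; apply/existsP.
have /codomP[v ->] : k \in codom [ffun v => Ordinal (lt_index v)].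
  by apply: inj_card_onto => //; rewrite card_ord.
by exists v.
Qed.

Lemma index_rev_uniq (T : eqType) (s : seq T) (x : T) : uniq s -> x \in s ->
  (index x (rev s) = size s - (index x s).+1)%N.
Proof.
move=> us xs; have lt_x : (index x s < size s)%N by rewrite index_mem.
(* Once [x] is written as the entry of [rev s] at the claimed place, uniqueness gives its index. *)
have {1}-> : x = nth x (rev s) (size s - (index x s).+1).
  rewrite nth_rev; last by lia.
  have -> : (size s - (size s - (index x s).+1).+1 = index x s)%N by lia.
  by rewrite nth_index.
by rewrite index_uniq ?rev_uniq ?size_rev //; lia.
Qed.

Lemma max_val_ge (D : digraph) (X : {set D}) :
  (#|D| * #|edges_between X (~: X)| <= 2 * max_val D)%N.
Proof.
have perm_blocks : perm_eq (enum X ++ enum (~: X)) (enum D).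
  apply: uniq_perm => [||v].
  - rewrite cat_uniq !enum_uniq andbT /=; apply/hasPn => v.
    by rewrite !mem_enum inE.
  - exact: enum_uniq.
  - by rewrite mem_cat !mem_enum !inE orbN.
have perm_revs : perm_eq (rev (enum X) ++ rev (enum (~: X))) (enum D).
  by apply: perm_trans perm_blocks; apply: perm_cat; rewrite perm_rev.
have [pi arr_pi piE] := arrangement_of_seq _ _ perm_blocks.
have [rho arr_rho rhoE] := arrangement_of_seq _ _ perm_revs.
have le_max (sigma : {ffun D -> 'I_#|D|}) :
    arrangement sigma -> (arrangement_val sigma <= max_val D)%N.
  exact: leq_bigmax_cond.
(* Both values are at most [max_val D], so it suffices to bound their sum from below, edge by
   edge. *)
apply: (@leq_trans (arrangement_val pi + arrangement_val rho)); last first.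
  by rewrite mul2n -addnn leq_add ?le_max.
rewrite /arrangement_val -big_split /= card_edges_between big_distrr /=.
apply: leq_sum => -[u v] _ /=; rewrite /edge_val /pos /= !piE !rhoE.
have [/andP[uX vX]|] := boolP ((u \in X) && _); last by rewrite muln0.
have vNX : v \in X = false by move: vX; rewrite inE => /negbTE.
(* With [i], [j] the indices of [u], [v] in their blocks, the two differences are [#|X| + j - i] and
   [#|~: X| - j + i]. *)
rewrite !index_cat !mem_rev !mem_enum uX vNX size_rev.
rewrite !index_rev_uniq ?enum_uniq ?mem_enum //.
have : (index u (enum X) < size (enum X))%N by rewrite index_mem mem_enum.
have : (index v (enum (~: X)) < size (enum (~: X)))%N.
  by rewrite index_mem mem_enum.
by rewrite -!cardE -(cardsC X); lia.
Qed.

Theorem theorem3p1 (D : digraph) (n t : nat)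
    (hn : #|D| = n) (ht : maxDiCut D = t) :
  (1 / 2) * n%:R * t%:R <= (max_val D)%:R :> rat /\
  (max_val D)%:R <= (n%:R - 1) * t%:R :> rat.
Proof.
split.
  have le_cut : (n * t <= 2 * max_val D)%N.
    (* The maximum is attained because its index type contains [set0]. *)
    have [|X eq_X] := @bigop.eq_bigmax {set D}
      (fun X => #|edges_between X (~: X)|).
      by apply/card_gt0P; exists set0.
    by rewrite -hn -ht [maxDiCut D]eq_X max_val_ge.
  by move: le_cut; rewrite -(ler_nat rat) !natrM; lra.
have le_val : (max_val D <= n.-1 * t)%N.
  by apply/bigmax_leqP => pi _; rewrite -hn -ht arrangement_val_le.
case: n hn le_val => [|n] hn le_val; last first.
  by rewrite -natr1 addrK -natrM ler_nat.
(* On the empty digraph the factor [n - 1 = -1] is harmless because [t = 0]. *)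
have t0 : t = 0%N.
  apply/eqP; rewrite -leqn0 -ht; apply/bigmax_leqP => X _.
  by rewrite (leq_trans (max_card _)) // card_prod hn.
by move: le_val; rewrite t0 mulr0 mul0n leqn0 => /eqP ->.
Qed.
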